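(* a) The quaternion algebras $\mathbb{H}_{\mathbb{Q}}(-1,-1)$, $\mathbb{H}_{\mathbb{Q}}(-1,-2)$, $\mathbb{H}_{\mathbb{Q}}(-2,-2)$, $\mathbb{H}_{\mathbb{Q}}(-2,-3)$, $\mathbb{H}_{\mathbb{Q}}(-2,-4)$ are isomorphic (as $\mathbb{Q}$-algebras). b) The quaternion algebras $\mathbb{H}_{\mathbb{Q}}(-1,-3)$ and $\mathbb{H}_{\mathbb{Q}}(-2,-5)$ are not isomorphic to each other, and neither of them is isomorphic to any of the $5$ quaternion algebras $\mathbb{H}_{\mathbb{Q}}(-1,-1)$, $\mathbb{H}_{\mathbb{Q}}(-1,-2)$, $\mathbb{H}_{\mathbb{Q}}(-2,-2)$, $\mathbb{H}_{\mathbb{Q}}(-2,-3)$, $\mathbb{H}_{\mathbb{Q}}(-2,-4)$.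
   Context: For positive integers $b,c$, $\mathbb{H}_{\mathbb{Q}}(-b,-c)$ is the 4-dimensional associative unital $\mathbb{Q}$-algebra with basis $\{1,e_2,e_3,e_4\}$ and $e_2^2=-b$, $e_3^2=-c$, $e_2e_3=-e_3e_2=e_4$. *)

(* Defs.v *)
From HB Require Import structures.
From mathcomp Require Import all_boot all_order all_algebra.
From mathcomp Require Import ring.
Set Implicit Arguments.
Unset Strict Implicit.
Unset Printing Implicit Defensive.

Import GRing.Theory.
Local Open Scope ring_scope.

(* [Quat x1 x2 x3 x4] stands for x1 + x2 e2 + x3 e3 + x4 e4 in the algebra with
   e2^2 = a, e3^2 = b and e2 e3 = - e3 e2 = e4. *)
Record quat (R : comNzRingType) (a b : R) :=
  Quat { qc1 : R; qc2 : R; qc3 : R; qc4 : R }.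

Notation "\H_Q( a , b )" := (@quat rat a%R b%R)
  (at level 8, a at level 99, b at level 99, format "\H_Q( a ,  b )")
  : type_scope.

Section QuaternionAlgebra.
Variables (R : comNzRingType) (a b : R).
Local Notation H := (quat a b).

Definition quat_to_prod (x : H) : R * R * R * R :=
  (qc1 x, qc2 x, qc3 x, qc4 x).
Definition prod_to_quat (p : R * R * R * R) : H :=
  let: (x1, x2, x3, x4) := p in Quat a b x1 x2 x3 x4.
Lemma quat_to_prodK : cancel quat_to_prod prod_to_quat.
Proof. by case. Qed.

HB.instance Definition _ := Choice.copy H (can_type quat_to_prodK).

Definition quat0 : H := Quat a b 0 0 0 0.
Definition quat_opp (x : H) : H :=
  Quat a b (- qc1 x) (- qc2 x) (- qc3 x) (- qc4 x).
Definition quat_add (x y : H) : H :=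
  Quat a b (qc1 x + qc1 y) (qc2 x + qc2 y) (qc3 x + qc3 y) (qc4 x + qc4 y).

Fact quat_addA : associative quat_add.
Proof. by move=> x y z; rewrite /quat_add /= !addrA. Qed.
Fact quat_addC : commutative quat_add.
Proof.
by move=> x y; congr Quat; apply: addrC.
Qed.
Fact quat_add0 : left_id quat0 quat_add.
Proof. by case=> *; rewrite /quat_add /= !add0r. Qed.
Fact quat_addN : left_inverse quat0 quat_opp quat_add.
Proof. by case=> *; rewrite /quat_add /= !addNr. Qed.

HB.instance Definition _ :=
  GRing.isZmodule.Build H quat_addA quat_addC quat_add0 quat_addN.

Definition quat1 : H := Quat a b 1 0 0 0.

(* Here e4^2 = - a b, e2 e4 = a e3, e4 e2 = - a e3, e4 e3 = b e2 and
   e3 e4 = - b e2. *)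
Definition quat_mul (x y : H) : H :=
  let: Quat x1 x2 x3 x4 := x in
  let: Quat y1 y2 y3 y4 := y in
  Quat a b
    (x1 * y1 + a * (x2 * y2) + b * (x3 * y3) - a * b * (x4 * y4))
    (x1 * y2 + x2 * y1 - b * (x3 * y4) + b * (x4 * y3))
    (x1 * y3 + x3 * y1 + a * (x2 * y4) - a * (x4 * y2))
    (x1 * y4 + x4 * y1 + x2 * y3 - x3 * y2).

Fact quat_mulA : associative quat_mul.
Proof. by case=> ????; case=> ????; case=> ????; congr Quat; ring. Qed.
Fact quat_mul1l : left_id quat1 quat_mul.
Proof. by case=> ????; congr Quat; ring. Qed.
Fact quat_mul1r : right_id quat1 quat_mul.
Proof. by case=> ????; congr Quat; ring. Qed.
Fact quat_mulDl : left_distributive quat_mul +%R.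
Proof. by case=> ????; case=> ????; case=> ????; congr Quat => /=; ring. Qed.
Fact quat_mulDr : right_distributive quat_mul +%R.
Proof. by case=> ????; case=> ????; case=> ????; congr Quat => /=; ring. Qed.
Fact quat1_neq0 : quat1 != 0.
Proof. by apply/eqP => -[] /eqP; rewrite oner_eq0. Qed.

HB.instance Definition _ := GRing.Zmodule_isNzRing.Build H
  quat_mulA quat_mul1l quat_mul1r quat_mulDl quat_mulDr quat1_neq0.

Definition quat_scale (k : R) (x : H) : H :=
  Quat a b (k * qc1 x) (k * qc2 x) (k * qc3 x) (k * qc4 x).

Fact quat_scaleA k l x :
  quat_scale k (quat_scale l x) = quat_scale (k * l) x.
Proof. by rewrite /quat_scale /= !mulrA. Qed.
Fact quat_scale1 : left_id 1 quat_scale.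
Proof. by case=> *; rewrite /quat_scale /= !mul1r. Qed.
Fact quat_scaleDr : right_distributive quat_scale +%R.
Proof. by move=> k x y; rewrite /quat_scale /= !mulrDr. Qed.
Fact quat_scaleDl x : {morph quat_scale^~ x : k l / k + l}.
Proof. by move=> k l; rewrite /quat_scale /= !mulrDl. Qed.

HB.instance Definition _ := GRing.Zmodule_isLmodule.Build R H
  quat_scaleA quat_scale1 quat_scaleDr quat_scaleDl.

Fact quat_scaleAl (k : R) (x y : H) : k *: (x * y) = (k *: x) * y.
Proof. by case: x y => ???? [????]; congr Quat => /=; ring. Qed.

HB.instance Definition _ := GRing.Lmodule_isLalgebra.Build R H quat_scaleAl.

Fact quat_scaleAr (k : R) (x y : H) : k *: (x * y) = x * (k *: y).
Proof. by case: x y => ???? [????]; congr Quat => /=; ring. Qed.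

HB.instance Definition _ := GRing.Lalgebra_isAlgebra.Build R H quat_scaleAr.

Definition quat_e2 : H := Quat a b 0 1 0 0.
Definition quat_e3 : H := Quat a b 0 0 1 0.
Definition quat_e4 : H := Quat a b 0 0 0 1.

Lemma quat_e2_sq : quat_e2 ^+ 2 = a%:A.
Proof. by congr Quat => /=; ring. Qed.
Lemma quat_e3_sq : quat_e3 ^+ 2 = b%:A.
Proof. by congr Quat => /=; ring. Qed.
Lemma quat_e2e3 : quat_e2 * quat_e3 = quat_e4.
Proof. by congr Quat => /=; ring. Qed.
Lemma quat_e3e2 : quat_e3 * quat_e2 = - quat_e4.
Proof. by congr Quat => /=; ring. Qed.

Lemma quat_basisE (x1 x2 x3 x4 : R) :
  x1 *: 1 + x2 *: quat_e2 + x3 *: quat_e3 + x4 *: quat_e4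
    = Quat a b x1 x2 x3 x4.
Proof. by congr Quat => /=; ring. Qed.

End QuaternionAlgebra.

Definition alg_isomorphic (R : nzRingType) (A B : algType R) : Prop :=
  exists f : {lrmorphism A -> B}, bijective f.

(* Main.v *)
Require Import Defs.
From HB Require Import structures.
From mathcomp Require Import all_boot all_order all_algebra.
From mathcomp Require Import ring lra zify.
Set Implicit Arguments.
Unset Strict Implicit.
Unset Printing Implicit Defensive.

Import Order.TTheory GRing.Theory Num.Theory.
Local Open Scope ring_scope.

(** Two ideas carry the proof.

    For the isomorphisms, replace the generator [e3] of the algebra with
    parameters [a, b] by [(s + t e2) e3].  It still anticommutes with [e2], and
    its square is [b] times the norm [s^2 - a t^2] of [s + t e2]; hence the
    second parameter may be multiplied by any nonzero norm from the field
    generated by [e2] ([quat_norm_twist]).  Since 2 = 1 + 1 is a norm for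
    [a = -1], while 2 = 0 + 2, 3 = 1 + 2 and 4 = 4 + 0 are norms for [a = -2],
    the five algebras all reduce to the Hamilton quaternions, after exchanging
    the two generators once ([quat_swap]) to pass from [a = -1] to [a = -2].

    For the non-isomorphisms, the invariant is the set of negative rationals
    [c] that have a square root in the algebra.  Such a root is a pure
    quaternion, so [c] has a root exactly when the ternary form
    [a x^2 + b y^2 - a b z^2] represents [c] over the rationals
    ([quat_sqrt_neg]).
    - [-7] has a root in the algebras with parameters [-1, -3] and [-2, -5],
      because 7 = 2^2 + 3 * 1^2 and 7 = 2 * 1^2 + 5 * 1^2.  It has none in the
      Hamilton quaternions, because 7 is not a sum of three rational squares
      (descent at 2).
    - [-1] has a root in the algebra with parameters [-1, -3], namely [e2], but
      none in the one with parameters [-2, -5], because 1 is not of the form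
      [2 x^2 + 5 y^2 + 10 z^2] (descent at 5).

    These obstructions are what the ramification of the algebras predicts: the
    three classes ramify, besides infinity, at 3, at 5 and at 2, and a
    quadratic field embeds exactly when no ramified place splits in it. *)

(** * Isomorphisms between quaternion algebras *)

Section AlgIsomorphic.
Variable R : nzRingType.
Implicit Types A B C : algType R.

Lemma alg_isomorphic_sym A B : alg_isomorphic A B -> alg_isomorphic B A.
Proof.
case=> f [g fK gK].
pose gL := GRing.isLinear.Build R B A *:%R g (can2_linear fK gK).
pose gM := GRing.isMonoidMorphism.Build B A g (can2_monoid_morphism fK gK).
pose h : {lrmorphism B -> A} := HB.pack g gL gM.
by exists h; exists f.
Qed.

Lemma alg_isomorphic_trans A B C :
  alg_isomorphic A B -> alg_isomorphic B C -> alg_isomorphic A C.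
Proof.
case=> f f_bij [g g_bij]; exists (g \o f : {lrmorphism A -> C}).
exact: bij_comp.
Qed.

End AlgIsomorphic.

Lemma quat_isomorphic_of_fun (R : comNzRingType) (a b a' b' : R)
    (f : quat a b -> quat a' b') :
    (forall k x y, f (k *: x + y) = k *: f x + f y) ->
    f 1 = 1 -> (forall x y, f (x * y) = f x * f y) -> bijective f ->
  alg_isomorphic (quat a b) (quat a' b').
Proof.
move=> f_lin f1 fM f_bij.
pose fL := GRing.isLinear.Build R _ _ *:%R f f_lin.
pose fMM := GRing.isMonoidMorphism.Build _ _ f (f1, fM).
by exists (HB.pack f fL fMM : {lrmorphism quat a b -> quat a' b'}).
Qed.

(** Exchanging [e2] and [e3] turns [e4 = e2 e3] into [e3 e2 = - e4]. *)
Lemma quat_swap (R : comNzRingType) (a b : R) :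
  alg_isomorphic (quat a b) (quat b a).
Proof.
pose f (c d : R) (x : quat c d) : quat d c :=
  Quat d c (qc1 x) (qc3 x) (qc2 x) (- qc4 x).
have fK c d : cancel (f c d) (f d c) by case=> *; rewrite /f /= opprK.
apply: (@quat_isomorphic_of_fun _ _ _ _ _ (f a b)).
- by move=> k [????] [????]; congr Quat => /=; ring.
- by congr Quat => /=; ring.
- by move=> [????] [????]; congr Quat => /=; ring.
- by exists (f b a).
Qed.

(** The generator [e3] is sent to [(s + t e2) e3], and hence [e4] to
    [e2 (s + t e2) e3 = (a t + s e2) e3].  On the last two coordinates this is
    a linear map of determinant [s^2 - a t^2], so it is invertible. *)
Lemma quat_norm_twist (F : fieldType) (a b s t : F) :
    s ^+ 2 - a * t ^+ 2 != 0 ->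
  alg_isomorphic (quat a (b * (s ^+ 2 - a * t ^+ 2))) (quat a b).
Proof.
set n := s ^+ 2 - a * t ^+ 2 => n_neq0.
pose f (x : quat a (b * n)) :=
  Quat a b (qc1 x) (qc2 x) (s * qc3 x + a * t * qc4 x)
    (t * qc3 x + s * qc4 x).
pose g (y : quat a b) :=
  Quat a (b * n) (qc1 y) (qc2 y) ((s * qc3 y - a * t * qc4 y) / n)
    ((s * qc4 y - t * qc3 y) / n).
apply: (@quat_isomorphic_of_fun _ _ _ _ _ f).
- by move=> k [????] [????]; congr Quat => /=; ring.
- by congr Quat => /=; ring.
- by move=> [????] [????]; rewrite /f /n; congr Quat => /=; ring.
- exists g.
  + by case=> *; rewrite /f /g; congr Quat => //=; rewrite /n; field.
  + by case=> *; rewrite /f /g; congr Quat => //=; rewrite /n; field.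
Qed.

Lemma quat_isomorphic_hamilton (p : rat * rat) :
    p \in [:: (-1, -1); (-1, -2); (-2, -2); (-2, -3); (-2, -4)] ->
  alg_isomorphic \H_Q(p.1, p.2) \H_Q(-1, -1).
Proof.
have twist a b c s t : c = b * (s ^+ 2 - a * t ^+ 2) -> c != 0 ->
    alg_isomorphic \H_Q(a, c) \H_Q(a, b).
  move=> -> /negP c_neq0; apply: quat_norm_twist.
  by apply/eqP => n0; apply: c_neq0; rewrite n0 mulr0.
have iso12 : alg_isomorphic \H_Q(-1, -2) \H_Q(-1, -1).
  exact: (@twist _ _ _ 1 1).
have iso21 : alg_isomorphic \H_Q(-2, -1) \H_Q(-1, -1).
  exact: alg_isomorphic_trans (@quat_swap _ _ _) iso12.
rewrite !inE => /or4P[| | |/orP[|]] /eqP-> /=.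
- exact: (@twist _ _ _ 1 0).
- exact: iso12.
- by apply: alg_isomorphic_trans iso21; exact: (@twist _ _ _ 0 1).
- by apply: alg_isomorphic_trans iso21; exact: (@twist _ _ _ 1 1).
- by apply: alg_isomorphic_trans iso21; exact: (@twist _ _ _ 2 0).
Qed.

(** * Square roots of negative rationals in quaternion algebras *)

Lemma alg_isomorphic_sqrt (R : nzRingType) (A B : algType R) (c : R) :
    alg_isomorphic A B ->
  (exists x : A, x ^+ 2 = c%:A) -> exists y : B, y ^+ 2 = c%:A.
Proof.
by case=> f _ [x x2]; exists (f x); rewrite -rmorphXn x2; exact: rmorph_alg.
Qed.

(** If [x = x1 + v] with [v] pure, then the pure part of [x^2] is [2 x1 v].
    So either [v = 0], and then [x^2 = x1^2] cannot be negative, or [x1 = 0]. *)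
Lemma quat_sqrt_neg (F : realFieldType) (a b c : F) (x : quat a b) :
    c < 0 -> x ^+ 2 = c%:A ->
  a * qc2 x ^+ 2 + b * qc3 x ^+ 2 - a * b * qc4 x ^+ 2 = c.
Proof.
case: x => x1 x2 x3 x4 c_lt0; rewrite expr2 => -[/= e1 e2 e3 e4].
have [x1_0|x1_neq0] := eqVneq x1 0; first by move: e1; rewrite x1_0; lra.
have pure_eq0 y : x1 * y = 0 -> y = 0.
  by move/eqP; rewrite mulf_eq0 (negPf x1_neq0) => /eqP.
have x2_0 : x2 = 0 by apply: pure_eq0; lra.
have x3_0 : x3 = 0 by apply: pure_eq0; move: e3; rewrite x2_0; lra.
have x4_0 : x4 = 0 by apply: pure_eq0; move: e4; rewrite x2_0; lra.
by move: e1; rewrite x2_0 x3_0 x4_0; nra.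
Qed.

(** * Descent for diagonal quaternary forms *)

(** Infinite descent on [|w|]: the equation is homogeneous, so a solution
    divisible by [n] can be divided by [n], and [|w|] decreases unless
    [w = 0]. *)
Lemma int_descent (n : nat) (a b c d : int) :
    (1 < n)%N ->
    (forall x y z w : int,
       a * x ^+ 2 + b * y ^+ 2 + c * z ^+ 2 + d * w ^+ 2 = 0 ->
       exists x' y' z' w' : int,
         [/\ x = n%:Z * x', y = n%:Z * y', z = n%:Z * z' & w = n%:Z * w']) ->
  forall x y z w : int,
    a * x ^+ 2 + b * y ^+ 2 + c * z ^+ 2 + d * w ^+ 2 = 0 -> w = 0.
Proof.
move=> n_gt1 div_n x y z w.
have [m] := ubnP `|w|%N; elim: m x y z w => // m IHm x y z w ltwm eq0.
have [x' [y' [z' [w' [xE yE zE wE]]]]] := div_n x y z w eq0.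
rewrite wE; suff -> : w' = 0 by rewrite mulr0.
have [//|w'_neq0] := eqVneq w' 0.
apply: (IHm x' y' z').
  rewrite -ltnS; apply: leq_trans ltwm; rewrite ltnS wE abszM absz_nat.
  by rewrite ltn_Pmull // absz_gt0.
have n2_neq0 : n%:Z ^+ 2 != 0 by rewrite expf_neq0 //; lia.
by apply: (mulfI n2_neq0); rewrite mulr0 -eq0 xE yE zE wE; ring.
Qed.

Lemma common_denom (x y z : rat) : exists X Y Z D : int,
  [/\ D != 0, x = X%:~R / D%:~R, y = Y%:~R / D%:~R & z = Z%:~R / D%:~R].
Proof.
exists (numq x * denq y * denq z), (denq x * numq y * denq z),
  (denq x * denq y * numq z), (denq x * denq y * denq z).
have dx : (denq x)%:~R != 0 :> rat by rewrite intr_eq0 denq_neq0.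
have dy : (denq y)%:~R != 0 :> rat by rewrite intr_eq0 denq_neq0.
have dz : (denq z)%:~R != 0 :> rat by rewrite intr_eq0 denq_neq0.
split; first by rewrite !mulf_neq0 ?denq_neq0.
- by rewrite -{1}[x]divq_num_den !rmorphM /=; field; rewrite dx dy dz.
- by rewrite -{1}[y]divq_num_den !rmorphM /=; field; rewrite dx dy dz.
- by rewrite -{1}[z]divq_num_den !rmorphM /=; field; rewrite dx dy dz.
Qed.

Lemma rat_descent (n : nat) (a b c d : int) :
    (1 < n)%N ->
    (forall x y z w : int,
       a * x ^+ 2 + b * y ^+ 2 + c * z ^+ 2 + d * w ^+ 2 = 0 ->
       exists x' y' z' w' : int,
         [/\ x = n%:Z * x', y = n%:Z * y', z = n%:Z * z' & w = n%:Z * w']) ->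
  forall x y z : rat,
    a%:~R * x ^+ 2 + b%:~R * y ^+ 2 + c%:~R * z ^+ 2 + d%:~R <> 0.
Proof.
move=> n_gt1 div_n x y z eq0.
have [X [Y [Z [D [D_neq0 xE yE zE]]]]] := common_denom x y z.
have Dr_neq0 : D%:~R != 0 :> rat by rewrite intr_eq0.
suff /(int_descent n_gt1 div_n) D0 :
    a * X ^+ 2 + b * Y ^+ 2 + c * Z ^+ 2 + d * D ^+ 2 = 0.
  by rewrite D0 in D_neq0.
apply: (@intr_inj rat); rewrite !(rmorphD, rmorphM, rmorphXn) /=.
rewrite -[RHS](mul0r (D%:~R ^+ 2)) -eq0 xE yE zE.
by field.
Qed.

(** An odd square is 1 modulo 8 because it has the form
    [(2 q + 1)^2 = 4 q (q + 1) + 1], with [q (q + 1)] even. *)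
Lemma int_even_or_odd (x : int) :
  (exists2 k, x = 2 * k & exists m, x ^+ 2 = 4 * m)
  \/ exists k, x ^+ 2 = 8 * k + 1.
Proof.
have [r|r] : (x %% 2)%Z = 0 \/ (x %% 2)%Z = 1 by lia.
  have xE : x = 2 * (x %/ 2)%Z by lia.
  left; exists (x %/ 2)%Z => //; exists ((x %/ 2)%Z ^+ 2).
  by rewrite {1}xE; ring.
right; set q := (x %/ 2)%Z; have xE : x = 2 * q + 1 by rewrite /q; lia.
have [k qE] : exists k, q * (q + 1) = 2 * k.
  have [e|e] : (q %% 2)%Z = 0 \/ (q %% 2)%Z = 1 by lia.
    exists ((q %/ 2)%Z * (q + 1)).
    have {1}-> : q = 2 * (q %/ 2)%Z by lia.
    by ring.
  exists (q * ((q + 1) %/ 2)%Z).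
  have {1}-> : q + 1 = 2 * ((q + 1) %/ 2)%Z by lia.
  by ring.
exists k; rewrite xE -[8]/(4 * 2 : int) -mulrA -qE; ring.
Qed.

(** From [x^2 + y^2 + z^2 = 7 w^2] one gets that 8 divides
    [x^2 + y^2 + z^2 + w^2].  Modulo 4 this sum is the number of odd terms, and
    four odd terms give 4 modulo 8, so all terms are even. *)
Lemma three_squares_neq7 (x y z : rat) :
  (-1) * x ^+ 2 + (-1) * y ^+ 2 + (-1) * z ^+ 2 + 7 <> 0.
Proof.
apply: (@rat_descent 2 (-1) (-1) (-1) 7) => // {}x {}y {}z w eq0.
case: (int_even_or_odd x) => [[x' xE [m xm]]|[m xm]];
case: (int_even_or_odd y) => [[y' yE [m1 ym]]|[m1 ym]];
case: (int_even_or_odd z) => [[z' zE [m2 zm]]|[m2 zm]];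
case: (int_even_or_odd w) => [[w' wE [m3 wm]]|[m3 wm]].
  by exists x', y', z', w'.
all: exfalso; rewrite {}xm {}ym {}zm {}wm in eq0.
all: by clear -eq0; lia.
Qed.

(** 2 is not a square modulo 5. *)
Lemma sqr2_sub_sqr_dvd5 (u v k : int) :
    2 * u ^+ 2 - v ^+ 2 = 5 * k ->
  exists u' v' : int, u = 5 * u' /\ v = 5 * v'.
Proof.
move=> uvk; exists (u %/ 5)%Z, (v %/ 5)%Z.
pose q := (u %/ 5)%Z; pose r := (u %% 5)%Z.
pose q' := (v %/ 5)%Z; pose r' := (v %% 5)%Z.
have uE : u = 5 * q + r by rewrite /q /r; lia.
have vE : v = 5 * q' + r' by rewrite /q' /r'; lia.
have [l lE] : exists l, 2 * r ^+ 2 - r' ^+ 2 = 5 * l.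
  exists (k - 2 * (5 * q ^+ 2 + 2 * q * r) + (5 * q' ^+ 2 + 2 * q' * r')).
  rewrite mulrDr mulrBr -uvk uE vE; ring.
have : 0 <= r < 5 by rewrite /r; lia.
have : 0 <= r' < 5 by rewrite /r'; lia.
case/andP=> r'_ge0 r'_lt5 /andP[r_ge0 r_lt5].
have r_cases : r = 0 \/ r = 1 \/ r = 2 \/ r = 3 \/ r = 4 by lia.
have r'_cases : r' = 0 \/ r' = 1 \/ r' = 2 \/ r' = 3 \/ r' = 4 by lia.
have [r0 r'0] : r = 0 /\ r' = 0.
  by case: r_cases lE => [|[|[|[|]]]] ->;
    case: r'_cases => [|[|[|[|]]]] ->; lia.
by rewrite -/q -/q' uE vE r0 r'0 !addr0.
Qed.

(** Modulo 5 the equation [2 x^2 + 5 y^2 + 10 z^2 = w^2] reads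
    [2 x^2 = w^2], so 5 divides [x] and [w].  Dividing by 5 leaves
    [y^2 + 2 z^2 = 0] modulo 5, which doubles to [2 y^2 = z^2], so 5 divides
    [y] and [z] as well. *)
Lemma form_2_5_10_neq1 (x y z : rat) :
  (-2) * x ^+ 2 + (-5) * y ^+ 2 + (-10) * z ^+ 2 + 1 <> 0.
Proof.
apply: (@rat_descent 5 (-2) (-5) (-10) 1) => // {}x {}y {}z w eq0.
have [x' [w' [xE wE]]] :
    exists x' w' : int, x = 5 * x' /\ w = 5 * w'.
  by apply: (@sqr2_sub_sqr_dvd5 _ _ (- y ^+ 2 - 2 * z ^+ 2)); lia.
rewrite xE wE in eq0 *.
have [y' [z' [-> ->]]] :
    exists y' z' : int, y = 5 * y' /\ z = 5 * z'.
  apply: (@sqr2_sub_sqr_dvd5 _ _ (2 * (w' ^+ 2 - 2 * x' ^+ 2) - z ^+ 2));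
  lia.
by exists x', y', z', w'.
Qed.

Theorem proposition3p6 :
  let params : seq (rat * rat) :=
    [:: (-1, -1); (-1, -2); (-2, -2); (-2, -3); (-2, -4)] in
  (forall p q : rat * rat, p \in params -> q \in params ->
     alg_isomorphic \H_Q(p.1, p.2) \H_Q(q.1, q.2))
  /\ (~ alg_isomorphic \H_Q(-1, -3) \H_Q(-2, -5)
      /\ (forall p : rat * rat, p \in params ->
            ~ alg_isomorphic \H_Q(-1, -3) \H_Q(p.1, p.2)
            /\ ~ alg_isomorphic \H_Q(-2, -5) \H_Q(p.1, p.2))).
Proof.
move=> params.
have no_sqrt_m7 : ~ exists y : \H_Q(-1, -1), y ^+ 2 = (-7)%:A.
  case=> y /quat_sqrt_neg y2.
  apply: (@three_squares_neq7 (qc2 y) (qc3 y) (qc4 y)).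
  by have := y2 isT; lra.
have not_hamilton a b (p : rat * rat) : p \in params ->
    (exists x : \H_Q(a, b), x ^+ 2 = (-7)%:A) ->
    ~ alg_isomorphic \H_Q(a, b) \H_Q(p.1, p.2).
  move=> /quat_isomorphic_hamilton iso_p sqrt_m7 iso_ab; apply: no_sqrt_m7.
  exact: alg_isomorphic_sqrt (alg_isomorphic_trans iso_ab iso_p) sqrt_m7.
split; last split.
- move=> p q /quat_isomorphic_hamilton iso_p /quat_isomorphic_hamilton iso_q.
  exact: alg_isomorphic_trans iso_p (alg_isomorphic_sym iso_q).
- move=> iso.
  have [|y /quat_sqrt_neg y2] := alg_isomorphic_sqrt (c := -1) iso.
    by exists (quat_e2 _ _); exact: quat_e2_sq.
  apply: (@form_2_5_10_neq1 (qc2 y) (qc3 y) (qc4 y)).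
  by have := y2 isT; lra.
- move=> p p_in; split; apply: not_hamilton p_in _.
    by exists (Quat _ _ 0 2 1 0).
  by exists (Quat _ _ 0 1 1 0).
Qed.
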